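(* Let $H$ and $G$ be graphs with $\delta(G)=\delta$. If $$|V(H)|\leq \delta\, \chi_G(H)+\sqrt{\delta\, \chi_G(H)}-(\delta-1),$$ then $\chi_G^L(H)=\chi_G(H)$.
   Context: All graphs are finite, simple and undirected. For graphs $H$ and $G$, $H$ is $G$-free if $H$ contains no subgraph isomorphic to $G$. A $k$-$G$-free coloring of $H$ is a map $c:V(H)\to\{1,\dots,k\}$ such that each color class induces a $G$-free subgraph of $H$; $\chi_G(H)$ is the least $k$ for which such a coloring exists. A list assignment $L$ of $H$ assigns to each vertex $v$ a set $L(v)$ of colors; an $L$-$G$-free coloring is a map $c$ with $c(v)\in L(v)$ for all $v$ such that each color class induces a $G$-free subgraph of $H$. $H$ is $k$-$G$-free-choosable if it has an $L$-$G$-free coloring for every list assignment $L$ with $|L(v)|\ge k$ for all $v$; $\chi_G^L(H)$ is the least such $k$. $\delta(G)$ is the minimum degree of $G$. *)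

(* Defs.v *)
From HB Require Import structures.
From mathcomp Require Import all_boot all_order all_algebra finmap.

Set Implicit Arguments.
Unset Strict Implicit.
Unset Printing Implicit Defensive.

Record sgraph := SGraph {
  vertex :> finType;
  adj : rel vertex;
  adj_sym : symmetric adj;
  adj_irr : irreflexive adj
}.

Definition isomorphic (F G : sgraph) : Prop :=
  exists f : F -> G,
    bijective f /\ forall x y : F, adj (f x) (f y) = adj x y.

Record subgraph (H : sgraph) := Subgraph {
  sub_vset : {set H};
  sub_adj : rel H;
  sub_adj_sym : symmetric sub_adj;
  sub_adjP : forall x y : H,
    sub_adj x y -> [/\ x \in sub_vset, y \in sub_vset & adj x y]
}.

Section SubgraphGraph.
Variables (H : sgraph) (S : subgraph H).

Definition subgraph_vertex : finType := {x : H | x \in sub_vset S}.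

Definition subgraph_rel : rel subgraph_vertex :=
  fun x y => sub_adj S (val x) (val y).

Lemma subgraph_rel_sym : symmetric subgraph_rel.
Proof. by move=> x y; apply: sub_adj_sym. Qed.

Lemma subgraph_rel_irr : irreflexive subgraph_rel.
Proof. by move=> x; apply/negP => /sub_adjP[_ _]; rewrite adj_irr. Qed.

Definition subgraph_graph : sgraph := SGraph subgraph_rel_sym subgraph_rel_irr.

End SubgraphGraph.

Coercion subgraph_graph : subgraph >-> sgraph.

Section Induced.
Variables (H : sgraph) (A : {set H}).

Definition induced_rel : rel H := fun x y => [&& x \in A, y \in A & adj x y].

Lemma induced_rel_sym : symmetric induced_rel.
Proof. by move=> x y; rewrite /induced_rel adj_sym andbCA. Qed.

Lemma induced_relP (x y : H) :
  induced_rel x y -> [/\ x \in A, y \in A & adj x y].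
Proof. by case/and3P. Qed.

Definition induced : subgraph H := Subgraph induced_rel_sym induced_relP.

End Induced.

(* Subgraphs are not required to be induced. *)
Definition G_free (G H : sgraph) : Prop :=
  forall S : subgraph H, ~ isomorphic S G.

Definition G_free_coloring (G H : sgraph) (C : eqType) (c : H -> C) : Prop :=
  forall i : C, G_free G (induced [set v | c v == i]).

Definition G_free_colorable (G H : sgraph) (k : nat) : Prop :=
  exists c : H -> 'I_k, G_free_coloring G c.

Definition G_free_choosable (G H : sgraph) (k : nat) : Prop :=
  forall (C : choiceType) (L : H -> {fset C}),
    (forall v, k <= #|` L v|) ->
    exists c : H -> C, (forall v, c v \in L v) /\ G_free_coloring G c.

Definition is_least (P : nat -> Prop) (k : nat) : Prop :=
  P k /\ forall j, P j -> k <= j.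

(* The two parameters are relations between graphs and numbers because no k
   works when G has one vertex and H has at least one. *)
Definition is_G_free_chromatic_number (G H : sgraph) (k : nat) : Prop :=
  is_least (G_free_colorable G H) k.

Definition is_G_free_choice_number (G H : sgraph) (k : nat) : Prop :=
  is_least (G_free_choosable G H) k.

Definition degree (G : sgraph) (v : G) : nat := #|[set w | adj v w]|.

(* The graph with no vertices has no minimum degree. *)
Definition is_min_degree (G : sgraph) (d : nat) : Prop :=
  (exists v : G, degree v = d) /\ forall v : G, d <= degree v.

(* Main.v *)
Require Import Defs.
From mathcomp Require Import all_boot all_order all_algebra.
From mathcomp Require Import finmap zify lra.

Set Implicit Arguments.
Unset Strict Implicit.
Unset Printing Implicit Defensive.

(** Write [d] for the minimum degree of [G].  A set of at most [d] vertices is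
    [G]-free, so Hall's theorem with capacity [d] on every color settles all
    lists except on a set [X] with [d |L(X)| < |X|]; hence one may assume that
    the lists, of size [k], lie in a palette [C] with [d |C| < |V(H)|].  Start
    from a [G]-free [k]-coloring all of whose classes have at least [d]
    vertices.  Every list misses few colors of [C], so the classes with more
    than [d] vertices, treated from the largest to the smallest, receive
    distinct colors common to all their lists.  The other classes have exactly
    [d] vertices, and each of their vertices keeps as many free colors as there
    are such classes, so Hall's theorem with capacity [d] finishes. *)

(** * Hall's theorem, plain and with capacities *)

(** Induction on [#|X|]. A nonempty proper subset that is tight is matched inside its neighborhood
    and the rest outside it; if there is none, every such subset has a spare neighbor and one pair
    can be fixed freely. [t0] provides values when [X] is empty. *)
Lemma Hall_matching (A T : finType) (t0 : T) (X : {set A}) (r : A -> {set T}) :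
  (forall Y : {set A}, Y \subset X -> #|Y| <= #|\bigcup_(y in Y) r y|) ->
  exists f : A -> T, {in X &, injective f} /\ {in X, forall x, f x \in r x}.
Proof.
have [n] := ubnP #|X|; elim: n X r => // n IHn X r leXn hallX.
have [->|[x xX]] := set_0Vmem X.
  by exists (fun=> t0); split=> [x y|x]; rewrite inE.
have [/existsP[Y /and3P[YX Y0 tightY]]|noY] :=
  boolP [exists Y : {set A}, [&& Y \proper X, Y != set0 &
    #|\bigcup_(y in Y) r y| <= #|Y|]].
- set N := \bigcup_(y in Y) r y in tightY.
  have sYX := proper_sub YX.
  have ltYX := proper_card YX.
  have [||f1 [f1inj f1r]] := IHn Y r; first lia.
    by move=> Z sZ; apply: hallX (subset_trans sZ sYX).
  have cX : #|X :\: Y| = #|X| - #|Y| by rewrite cardsDS.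
  have Ygt0 : 0 < #|Y| by rewrite card_gt0.
  have [||f2 [f2inj f2r]] := IHn (X :\: Y) (fun x => r x :\: N); first lia.
    move=> Z /subsetDP[sZX dZY].
    have := hallX (Z :|: Y); rewrite subUset sZX sYX => /(_ isT).
    rewrite cardsU (disjoint_setI0 dZY) cards0 subn0 bigcup_setU -/N.
    have -> : \bigcup_(i in Z) r i :|: N = \bigcup_(y in Z) (r y :\: N) :|: N.
      apply/setP=> u; rewrite !inE; case uN: (u \in N); rewrite ?orbT ?orbF //.
      by apply/bigcupP/bigcupP => -[z zZ uz]; exists z => //; move: uz;
         rewrite inE uN.
    have := leq_of_leqif (leq_card_setU (\bigcup_(y in Z) (r y :\: N)) N).
    lia.
  exists (fun x => if x \in Y then f1 x else f2 x).
  have f1N y : y \in Y -> f1 y \in N.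
    by move=> yY; apply/bigcupP; exists y => //; apply: f1r.
  have f2N y : y \in X -> y \notin Y -> f2 y \notin N.
    move=> yX yY; have := f2r y; rewrite !inE yX yY => /(_ isT).
    by case/andP.
  split=> [y z yX zX|y yX].
    case: ifPn => yY; case: ifPn => zY; first exact: f1inj.
    + by move=> e; have := f2N z zX zY; rewrite -e f1N.
    + by move=> e; have := f2N y yX yY; rewrite e f1N.
    + by apply: f2inj; rewrite inE ?yY ?zY.
  case: ifPn => yY; first exact: f1r.
  by have := f2r y; rewrite !inE yX yY => /(_ isT) /andP[].
- have [t tx] : exists t, t \in r x.
    apply/set0Pn; rewrite -card_gt0.
    have := hallX [set x]; rewrite sub1set big_set1 cards1.
    exact.
  have cX : #|X| = #|X :\ x|.+1 by rewrite (cardsD1 x) xX.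
  have [||f [finj fr]] := IHn (X :\ x) (fun y => r y :\ t); first lia.
    move=> Z sZ; have [->|Z0] := eqVneq Z set0; first by rewrite cards0.
    have ZX : Z \proper X by apply: sub_proper_trans sZ (properD1 xX).
    move: noY; rewrite negb_exists => /forallP/(_ Z).
    rewrite ZX Z0 /= -ltnNge => ltZ.
    have := leq_of_leqif (leq_card_setU (\bigcup_(y in Z) (r y :\ t)) [set t]).
    rewrite cards1.
    have : #|\bigcup_(y in Z) r y| <= #|\bigcup_(y in Z) (r y :\ t) :|: [set t]|.
      apply: subset_leq_card; apply/subsetP=> u /bigcupP[z zZ uz].
      rewrite !inE; case: eqVneq => [|ut]; rewrite ?orbT // orbF.
      by apply/bigcupP; exists z => //; rewrite !inE ut.
    by lia.
  exists (fun y => if y == x then t else f y).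
  have ft y : y \in X -> y != x -> f y != t.
    by move=> yX yx; have := fr y; rewrite !inE yX yx => /(_ isT) /andP[].
  split=> [y z yX zX|y yX].
    case: eqVneq => [->|yx]; case: eqVneq => [->|zx] //.
    + by move=> e; have := ft z zX zx; rewrite -e eqxx.
    + by move=> e; have := ft y yX yx; rewrite e eqxx.
    + by apply: finj; rewrite !inE ?yx ?zx.
  case: eqVneq => [->//|yx].
  by have := fr y; rewrite !inE yX yx => /(_ isT) /andP[].
Qed.

(** Hall's theorem is applied to [d] copies [(u, j)] of each color; elements sharing a color differ
    in the index [j]. *)
Lemma Hall_capacity (A U : finType) (u0 : U) (d : nat) (X : {set A})
    (L : A -> {set U}) : 0 < d ->
  (forall Y : {set A}, Y \subset X -> #|Y| <= d * #|\bigcup_(y in Y) L y|) ->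
  exists g : A -> U, {in X, forall x, g x \in L x} /\
    forall u, #|[set x in X | g x == u]| <= d.
Proof.
move=> d0 hallX.
have [|f [finj fL]] := @Hall_matching A (U * 'I_d)%type (u0, Ordinal d0) X
    (fun x => setX (L x) setT).
  move=> Y /hallX; rewrite mulnC -{1}(card_ord d) -cardsT -cardsX.
  move=> /leq_trans; apply; apply: subset_leq_card.
  apply/subsetP=> -[u j]; rewrite !inE andbT => /bigcupP[y yY uy].
  by apply/bigcupP; exists y => //; rewrite !inE uy.
exists (fun x => (f x).1); split=> [x xX|u].
  by have := fL x xX; rewrite !inE andbT.
rewrite -[leqRHS]card_ord.
rewrite -(@card_in_imset _ _ (fun x => (f x).2)) ?max_card // => x y.
rewrite !inE => /andP[xX /eqP xu] /andP[yX /eqP yu] e.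
by apply: finj => //; rewrite [f x]surjective_pairing [f y]surjective_pairing xu yu e.
Qed.

(** * G-free sets and embeddings *)

Lemma G_free_embedP (G H : sgraph) :
  G_free G H <->
  ~ exists f : G -> H, injective f /\ forall x y, adj x y -> adj (f x) (f y).
Proof.
split=> [GH [f [finj fadj]]|nof S [f [[g fK gK] fadj]]]; last first.
  apply: nof; exists (fun x => val (g x)); split.
    by move=> x y /val_inj /(can_inj gK).
  move=> x y; rewrite -{1}(gK x) -{1}(gK y) fadj.
  by case/sub_adjP.
(* Only images of edges of [G] are kept: [f] may send non-adjacent vertices to adjacent ones, while
   the copy must be isomorphic to [G]. *)
pose e : rel H := fun x y => [exists u, exists v, [&& f u == x, f v == y & adj u v]].
have eP x y : e x y -> exists u v, [/\ f u = x, f v = y & adj u v].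
  by move=> /existsP[u /existsP[v /and3P[/eqP ? /eqP ? ?]]]; exists u, v.
have ef u v : e (f u) (f v) = adj u v.
  apply/idP/idP => [/eP[u' [v' [/finj-> /finj->]]]//|uv].
  by apply/existsP; exists u; apply/existsP; exists v; rewrite !eqxx.
have esym : symmetric e.
  suff es x y : e x y -> e y x by move=> x y; apply/idP/idP; apply: es.
  by case/eP=> u [v [<- <-]]; rewrite ef adj_sym -ef.
have esub x y : e x y -> [/\ x \in f @: setT, y \in f @: setT & adj x y].
  by case/eP=> u [v [<- <- uv]]; split; rewrite ?imset_f //; apply: fadj.
apply: (GH (Subgraph esym esub)).
have Sf (x : Subgraph esym esub) : exists u, f u == val x.
  by case: x => x /= /imsetP[u _ ->]; exists u.
have fS u : f u \in f @: setT by rewrite imset_f.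
exists (fun x => xchoose (Sf x)); split.
  exists (fun u => exist _ (f u) (fS u) : Subgraph esym esub).
    by move=> x; apply: val_inj; apply/eqP; apply: (xchooseP (Sf x)).
  by move=> u; apply: finj; apply/eqP; apply: (xchooseP (Sf _)).
move=> x y; rewrite -ef.
by rewrite (eqP (xchooseP (Sf x))) (eqP (xchooseP (Sf y))).
Qed.

Lemma G_free_inducedP (G H : sgraph) (A : {set H}) :
  G_free G (induced A) <->
  ~ exists f : G -> H, [/\ injective f, forall x, f x \in A &
      forall x y, adj x y -> adj (f x) (f y)].
Proof.
rewrite G_free_embedP; split=> nof [f].
  case=> finj fA fadj; apply: nof.
  exists (fun x => exist _ (f x) (fA x) : induced A); split=> [x y|x y xy].
    by move/(congr1 val)/finj.
  by apply/and3P; split=> /=; [exact: fA|exact: fA|exact: fadj].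
case=> finj fadj; apply: nof; exists (fun x => val (f x)); split.
- by move=> x y /val_inj/finj.
- by move=> x; apply: valP.
- by move=> x y /fadj /and3P[].
Qed.

Lemma G_free_inducedS (G H : sgraph) (A B : {set H}) :
  A \subset B -> G_free G (induced B) -> G_free G (induced A).
Proof.
move=> /subsetP sAB; rewrite !G_free_inducedP => nof [f [finj fA fadj]].
by apply: nof; exists f; split=> // x; apply: sAB.
Qed.

Lemma min_degree_lt_card (G : sgraph) (d : nat) : is_min_degree G d -> d < #|G|.
Proof.
case=> -[v <-] _; rewrite -cardsT; apply: proper_card.
by apply/properP; split; [exact: subsetT|exists v; rewrite ?inE ?adj_irr].
Qed.

Lemma G_free_induced_small (G H : sgraph) (d : nat) (A : {set H}) :
  is_min_degree G d -> #|A| <= d -> G_free G (induced A).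
Proof.
move=> /min_degree_lt_card dG Ad; apply/G_free_inducedP => -[f [finj fA _]].
have : #|f @: setT| <= #|A|.
  by apply: subset_leq_card; apply/subsetP=> _ /imsetP[x _ ->].
by rewrite card_imset // cardsT; lia.
Qed.

Lemma choosable_colorable (G H : sgraph) (k : nat) :
  G_free_choosable G H k -> G_free_colorable G H k.
Proof.
case/(_ 'I_k (fun=> [fset i | i in 'I_k]%fset)) => [v|c [_ cG]].
  by rewrite card_imfset //= size_enum_ord.
by exists c.
Qed.

(** * Class sizes and counting bounds *)

Lemma sum_card_classes (V : finType) (k : nat) (c : V -> 'I_k) :
  \sum_i #|[set v | c v == i]| = #|V|.
Proof.
rewrite -sum1_card (partition_big c predT) //=.
by apply: eq_bigr => i _; rewrite -sum1_card; apply: eq_bigl => v; rewrite inE.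
Qed.

(* A class with fewer than [d] vertices absorbs any further vertex, so the
   deficiency of a coloring can be lowered one vertex at a time. *)
Lemma balanced_coloring (G H : sgraph) (d k : nat) :
  is_min_degree G d -> d * k <= #|H| -> G_free_colorable G H k ->
  exists2 c : H -> 'I_k, G_free_coloring G c &
    forall i, d <= #|[set v | c v == i]|.
Proof.
move=> dG dkH [c cG].
have [n] := ubnP (\sum_i (d - #|[set v | c v == i]|)).
elim: n c cG => // n IHn c cG lecn.
have [allge|] := boolP [forall i, d <= #|[set v | c v == i]|].
  by exists c => //; apply/forallP.
rewrite negb_forall => /existsP[i]; rewrite -ltnNge => lti.
(* Otherwise the deficient class [i] would bring the total below [d * k]. *)
have [j ltj] : exists j, d < #|[set v | c v == j]|.
  apply/existsP; apply: contraLR dkH; rewrite negb_exists => /forallP lej.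
  rewrite -ltnNge -(sum_card_classes c) (bigD1 i) //=.
  have : \sum_(j | j != i) #|[set v | c v == j]| <= \sum_(j | j != i) d.
    by apply: leq_sum => j _; rewrite leqNgt.
  have dk : d * k = \sum_(j < k) d by rewrite sum_nat_const card_ord mulnC.
  move: dk; rewrite (bigD1 i) //=.
  lia.
have [v cv] : exists v, c v == j.
  have /card_gt0P[v] : 0 < #|[set v | c v == j]| by lia.
  by rewrite inE; exists v.
have ij : i != j by apply/eqP => e; rewrite -e in ltj; lia.
pose c' x := if x == v then i else c x.
have c'i : [set x | c' x == i] = v |: [set x | c x == i].
  by apply/setP=> x; rewrite !inE /c'; case: (eqVneq x v) => //=; rewrite eqxx.
have c'j l : l != i -> [set x | c' x == l] \subset [set x | c x == l].
  move=> li; apply/subsetP=> x; rewrite !inE /c'; case: (eqVneq x v) => // _.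
  by rewrite eq_sym (negPf li).
have c'jj : [set x | c' x == j] = [set x | c x == j] :\ v.
  apply/setP=> x; rewrite !inE /c'; case: (eqVneq x v) => //= _.
  exact: negPf.
have c'l l : l != i -> l != j -> [set x | c' x == l] = [set x | c x == l].
  move=> li lj; apply/setP=> x; rewrite !inE /c'; case: (eqVneq x v) => // ->.
  by rewrite (eqP cv) eq_sym (negPf li) eq_sym (negPf lj).
have szi : #|[set x | c' x == i]| = #|[set x | c x == i]|.+1.
  by rewrite c'i cardsU1 inE (eqP cv) eq_sym ij.
have szj : #|[set x | c x == j]| = #|[set x | c' x == j]|.+1.
  by rewrite c'jj (cardsD1 v) inE cv.
apply: (IHn c').
  move=> l; have [->|li] := eqVneq l i.
    by apply: (G_free_induced_small dG); rewrite szi.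
  exact: G_free_inducedS (c'j l li) (cG l).
have eqs : forall F : 'I_k -> nat, \sum_l F l = F i + \sum_(l | l != i) F l.
  by move=> F; rewrite (bigD1 i).
move: lecn; rewrite !eqs szi.
(* Class [j] has at least [d] vertices before and after the move, so its deficiency stays 0. *)
have -> : \sum_(l | l != i) (d - #|[set x | c' x == l]|) =
          \sum_(l | l != i) (d - #|[set x | c x == l]|).
  apply: eq_bigr => l li; have [->|lj] := eqVneq l j; last by rewrite c'l.
  lia.
lia.
Qed.

(** Meant for a palette of [k + t] colors and total excess [E]: a class of size [d + e], each of
    whose lists misses at most [t] colors, still has a common color after [m - 1] colors are
    used. *)
Lemma greedy_arith (d k t E e m : nat) : 0 < d -> 0 < e -> 0 < m ->
  m * e <= E -> d * t < E -> (E + d - 1) ^ 2 <= d * k ->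
  (d + e) * t + m <= k + t.
Proof.
move=> d0 e0 m0 meE dtE Ek.
(* Cancelling [t] and scaling by [d] lets each [d * t] be bounded by [E - 1]. *)
suff : d * ((d + e - 1) * t + m) <= d * k by rewrite leq_pmul2l //; nia.
apply: leq_trans Ek.
(* This is [(e - 1) * (m - 1) >= 0] combined with [m * e <= E]. *)
have emE : e + m <= E + 1 by nia.
have mE : m <= E by nia.
have [d' dE] : exists d', d = d'.+1 by exists d.-1; lia.
have [e' eE] : exists e', e = e'.+1 by exists e.-1; lia.
have [m' mE'] : exists m', m = m'.+1 by exists m.-1; lia.
have [F FE] : exists F, E = F.+1 by exists E.-1; lia.
subst d e m E.
have -> : d'.+1 + e'.+1 - 1 = d'.+1 + e' by lia.
have -> : F.+1 + d'.+1 - 1 = F + d'.+1 by lia.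
have h1 : d'.+1 * ((d'.+1 + e') * t) <= (d'.+1 + e') * F by nia.
have h2 : e' * F <= (F - m') * F by nia.
nia.
Qed.

Lemma card_bigcup_leq (I T : finType) (A : {set I}) (F : I -> {set T}) (t : nat) :
  (forall i, i \in A -> #|F i| <= t) -> #|\bigcup_(i in A) F i| <= #|A| * t.
Proof.
move=> Ft; rewrite -sum_nat_const.
apply: (big_ind2 (fun (X : {set T}) n => #|X| <= n)) => //.
  by rewrite cards0.
move=> X m Y n Xm Yn.
by have := leq_of_leqif (leq_card_setU X Y); lia.
Qed.

Lemma sum_class_excess (V : finType) (d k : nat) (c : V -> 'I_k) :
  (forall i, d <= #|[set v | c v == i]|) ->
  \sum_i (#|[set v | c v == i]| - d) = #|V| - d * k.
Proof.
by move=> dc; rewrite sumnB // sum_card_classes sum_nat_const card_ord mulnC.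
Qed.

(** * Lists inside a small palette *)

Section SmallPalette.

Variables (V U : finType) (u0 : U) (d k : nat) (c : V -> 'I_k).
Variables (C : {set U}) (L : V -> {set U}).
Hypothesis d_gt0 : 0 < d.
Hypothesis L_sub : forall v, L v \subset C.
Hypothesis k_leL : forall v, k <= #|L v|.
Hypothesis d_le_class : forall i, d <= #|[set v | c v == i]|.
Hypothesis C_small : d * #|C| < #|V|.
Hypothesis V_small : (#|V| - d * k + d - 1) ^ 2 <= d * k.

(* Colors are given to the largest classes first: when the smallest of [m] large
   classes is treated, its excess over [d] is at most a fraction [1/m] of the
   total excess. *)
Lemma large_classes_monochromatic (B : {set 'I_k}) :
  (forall i, i \in B -> d < #|[set v | c v == i]|) ->
  exists f : 'I_k -> U, {in B &, injective f} /\
    forall v, c v \in B -> f (c v) \in L v.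
Proof.
have [n] := ubnP #|B|; elim: n B => // n IHn B leBn largeB.
have [->|[i0 i0B]] := set_0Vmem B.
  by exists (fun=> u0); split=> [i j|v]; rewrite inE.
have [j jB minj] := @arg_minnP _ i0 [in B] (fun i => #|[set v | c v == i]|) i0B.
have cB : #|B| = #|B :\ j|.+1 by rewrite (cardsD1 j) jB.
have [||f [finj fL]] := IHn (B :\ j); first lia.
  by move=> i; rewrite !inE => /andP[_]; apply: largeB.
set W := [set v | c v == j] in minj.
have ltW : d < #|W| by apply: largeB.
have excessB : #|B| * (#|W| - d) <= #|V| - d * k.
  rewrite -(sum_class_excess d_le_class) (bigID (mem B)) /= -sum_nat_const.
  apply: leq_trans (leq_addr _ _); apply: leq_sum => i iB.
  by apply: leq_sub2r; apply: minj.
have [v0 _] : exists v0 : V, v0 \in V by apply/card_gt0P; exact: leq_ltn_trans C_small.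
have kC : k <= #|C| := leq_trans (k_leL v0) (subset_leq_card (L_sub v0)).
have missW : #|\bigcup_(v in W) (C :\: L v)| <= #|W| * (#|C| - k).
  apply: card_bigcup_leq => v _; rewrite cardsDS //.
  exact: leq_sub2l.
have usedB : #|f @: (B :\ j)| <= #|B :\ j| by apply: leq_imset_card.
(* The forbidden colors are those missing from some list on [W] and those given to the larger
   classes; the palette is not exhausted by them. *)
have ltC : #|(\bigcup_(v in W) (C :\: L v)) :|: f @: (B :\ j)| < #|C|.
  apply: leq_ltn_trans (leq_of_leqif (leq_card_setU _ _)) _.
  have := @greedy_arith d k (#|C| - k) (#|V| - d * k) (#|W| - d) #|B|.
  rewrite subnKC; last lia.
  move=> /(_ d_gt0) /(_ ltac:(lia)) /(_ ltac:(lia)) /(_ excessB).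
  move=> /(_ ltac:(nia)) /(_ V_small); lia.
have [u uC] : exists2 u, u \in C &
    u \notin (\bigcup_(v in W) (C :\: L v)) :|: f @: (B :\ j).
  apply/subsetPn; apply: contraL ltC => /subset_leq_card.
  by rewrite -leqNgt.
rewrite inE negb_or => /andP[/bigcupP nmiss nused].
exists (fun i => if i == j then u else f i).
have fu i : i \in B -> i != j -> f i != u.
  move=> iB ij; apply: contraNneq nused => <-.
  by apply: imset_f; rewrite !inE ij.
split=> [i l iB lB|v vB].
  case: eqVneq => [->|ij]; case: eqVneq => [->|lj] //.
  + by move=> e; have := fu l lB lj; rewrite -e eqxx.
  + by move=> e; have := fu i iB ij; rewrite e eqxx.
  + by apply: finj; rewrite !inE ?ij ?lj.
case: eqVneq => [cv|cv]; last by apply: fL; rewrite !inE cv.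
apply: contra_notT nmiss => nu; exists v; rewrite inE ?cv //.
by rewrite nu.
Qed.

(** Either alternative makes a color class G-free: it lies in a class of [c], or it is too small to
    contain [G]. *)
Lemma small_palette_coloring :
  exists g : V -> U, (forall v, g v \in L v) /\ forall u,
    (exists i, [set v | g v == u] \subset [set v | c v == i]) \/
    #|[set v | g v == u]| <= d.
Proof.
pose B := [set i | d < #|[set v | c v == i]|].
have [f [finj fL]] : exists f : 'I_k -> U, {in B &, injective f} /\
    forall v, c v \in B -> f (c v) \in L v.
  by apply: large_classes_monochromatic => i; rewrite inE.
have smallNB i : i \notin B -> #|[set v | c v == i]| <= d.
  by rewrite inE -leqNgt.
clearbody B.
pose X := [set v | c v \notin B].
have cX : #|X| <= d * (k - #|B|).
  have -> : X = \bigcup_(i in ~: B) [set v | c v == i].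
    apply/setP=> v; rewrite !inE; apply/idP/bigcupP => [vB|[i]].
      by exists (c v); rewrite !inE.
    by rewrite !inE => iB /eqP ->.
  have <- : #|~: B| = k - #|B| by rewrite cardsCs setCK card_ord.
  rewrite mulnC; apply: card_bigcup_leq => i.
  by rewrite inE; apply: smallNB.
(* At most [d * (k - #|B|)] vertices remain and each list keeps at least [k - #|B|] colors, so a
   single list already gives Hall's condition. *)
have [||h [hL hd]] := @Hall_capacity V U u0 d X (fun v => L v :\: f @: B) => //.
  move=> Y YX; have [->|[v vY]] := set_0Vmem Y; first by rewrite cards0.
  apply: leq_trans (subset_leq_card YX) (leq_trans cX _).
  rewrite leq_pmul2l //; apply: (@leq_trans #|L v :\: f @: B|); last first.
    by apply: subset_leq_card; apply: bigcup_sup vY.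
  have := leq_imset_card f B; rewrite cardsD.
  have := subset_leq_card (subsetIr (L v) (f @: B)).
  by have := k_leL v; lia.
exists (fun v => if c v \in B then f (c v) else h v).
have hB v : c v \notin B -> h v \in L v :\: f @: B.
  by move=> vB; apply: hL; rewrite inE.
split=> [v|u].
  by case: ifPn => [vB|vB]; [apply: fL|have := hB v vB; rewrite inE => /andP[]].
(* A color in [f @: B] is avoided by [h] and, by injectivity, occurs on one large class only. *)
have [/imsetP[i iB ->]|uB] := boolP (u \in f @: B).
  left; exists i; apply/subsetP=> v; rewrite !inE.
  case: ifPn => vB /eqP hv; first by rewrite (finj _ _ vB iB hv).
  have := hB v vB; rewrite inE => /andP[nB _].
  by rewrite hv imset_f in nB.
right; apply: leq_trans (hd u); apply: subset_leq_card.
apply/subsetP=> v; rewrite !inE.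
case: ifPn => [vB /eqP fu|//].
by rewrite -fu imset_f in uB.
Qed.

End SmallPalette.

(** * Reduction of arbitrary lists to a small palette *)

(* A maximal set [X] with [d |L(X)| < |X|] splits the problem: by maximality the
   vertices outside [X] satisfy Hall's condition for the colors outside [L(X)]. *)
Lemma list_coloring_finite (G H : sgraph) (d k : nat) (U : finType) (u0 : U)
    (L : H -> {set U}) :
  is_min_degree G d -> 0 < d -> G_free_colorable G H k ->
  (forall v, k <= #|L v|) ->
  (d * k < #|H| -> (#|H| - d * k + d - 1) ^ 2 <= d * k) ->
  exists g : H -> U, (forall v, g v \in L v) /\ G_free_coloring G g.
Proof.
move=> dG d0 Hk kL Hsmall.
pose N (X : {set H}) := \bigcup_(v in X) L v.
pose P (X : {set H}) := (X == set0) || (d * #|N X| < #|X|).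
have P0 : P set0 by rewrite /P eqxx.
have [X PX maxX] := @arg_maxnP _ set0 P (fun X => #|X|) P0.
have NX : d * #|N X| <= #|X|.
  by case/orP: PX => [/eqP->|/ltnW//]; rewrite /N big_set0 cards0 muln0.
have [||h [hL hd]] := @Hall_capacity H U u0 d (~: X) (fun v => L v :\: N X) => //.
  move=> Y YX; have [->|Y0] := eqVneq Y set0; first by rewrite cards0.
  have dXY : X :&: Y = set0.
    by apply: disjoint_setI0; rewrite disjoint_sym disjoints_subset.
  have cXY : #|X :|: Y| = #|X| + #|Y| by rewrite cardsU dXY cards0 subn0.
  have Ygt0 : 0 < #|Y| by rewrite card_gt0.
  have nP : ~~ P (X :|: Y).
    by apply/negP => /maxX; rewrite /= cXY; lia.
  move: nP; rewrite negb_or -leqNgt cXY => /andP[_].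
  have : #|N (X :|: Y)| <= #|N X| + #|\bigcup_(y in Y) (L y :\: N X)|.
    apply: leq_trans (leq_of_leqif (leq_card_setU _ _)).
    apply: subset_leq_card; apply/subsetP=> u; rewrite /N bigcup_setU !inE.
    case: (boolP (u \in _)) => //= uX /bigcupP[y yY uy].
    by apply/bigcupP; exists y; rewrite // inE uX.
  nia.
have [X0|X0] := eqVneq X set0.
  exists h; split=> [v|u].
    by have := hL v; rewrite X0 !inE => /(_ isT) /andP[].
  apply: (G_free_induced_small dG); apply: leq_trans (hd u).
  by apply: subset_leq_card; apply/subsetP=> v; rewrite X0 !inE.
have ltN : d * #|N X| < #|X| by move: PX; rewrite /P (negPf X0).
have LN v : v \in X -> L v \subset N X by move=> vX; apply: bigcup_sup.
have kN : k <= #|N X|.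
  have /set0Pn[v vX] := X0.
  exact: leq_trans (kL v) (subset_leq_card (LN v vX)).
have ltNH : d * #|N X| < #|H| by apply: leq_trans ltN (max_card _).
have dkH : d * k < #|H| by apply: leq_ltn_trans ltNH; rewrite leq_pmul2l.
have [|c cG dc] := @balanced_coloring G H d k dG _ Hk; first exact: ltnW.
(* The palette result colors all of [H], so vertices outside [X] get the dummy list [N X]; their
   colors under [g] are discarded. *)
have [||g [gL gu]] := @small_palette_coloring H U u0 d k c (N X)
    (fun v => if v \in X then L v else N X) d0 _ _ dc ltNH (Hsmall dkH) => //.
- by move=> v; case: ifP => // /LN.
- by move=> v; case: ifP.
exists (fun v => if v \in X then g v else h v).
have gN v : g v \in N X.
  have := gL v; case: ifP => // vX; apply/subsetP; exact: LN.
have hN v : v \notin X -> h v \in L v :\: N X.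
  by move=> vX; apply: hL; rewrite inE.
split=> [v|u].
  by case: ifP (gL v) => // /negbT /hN; rewrite inE => /andP[].
(* Colors of [N X] occur only on [X], through [g]; all others only outside [X], through [h]. *)
have [uN|uN] := boolP (u \in N X); last first.
  apply: (G_free_induced_small dG); apply: leq_trans (hd u).
  apply: subset_leq_card; apply/subsetP=> v; rewrite !inE.
  by case: ifP => // _ /eqP gv; rewrite -gv gN in uN.
apply: (@G_free_inducedS _ _ _ [set v | g v == u]).
  apply/subsetP=> v; rewrite !inE; case: ifPn => // /hN.
  by rewrite inE => /andP[nN _] /eqP hv; rewrite hv uN in nN.
have [[i gi]|] := gu u; first exact: G_free_inducedS gi (cG i).
exact: G_free_induced_small.
Qed.

(** * Arbitrary color types and the real bound *)

(** The union of the finitely many lists serves as a finite color type. The empty [H] is separate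
    because [C] may then have no element. *)
Lemma G_free_choosable_finite (G H : sgraph) (d k : nat) :
  is_min_degree G d -> (H -> 0 < k) ->
  (forall (U : finType) (u0 : U) (L : H -> {set U}), (forall v, k <= #|L v|) ->
    exists g : H -> U, (forall v, g v \in L v) /\ G_free_coloring G g) ->
  G_free_choosable G H k.
Proof.
move=> dG k0 choose C L kL.
have [/pred0P H0|/pred0Pn[v0 _]] := boolP (pred0b (T := H) predT).
  have noH (v : H) : False by have := H0 v.
  exists (fun v => False_rect _ (noH v)); split=> [v|i]; first by case: (noH v).
  apply: (G_free_induced_small dG).
  suff -> : [set v | False_rect C (noH v) == i] = set0 by rewrite cards0.
  by apply/setP=> v; case: (noH v).
pose U := (\bigcup_(v <- enum H) L v)%fset.
have LU v : (L v `<=` U)%fset by apply: bigfcup_sup; rewrite ?mem_enum.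
have cL v : #|[set u : U | val u \in L v]| = #|` L v|.
  exact: card_fsub (LU v).
have [u1 _] : exists u : U, u \in [set u : U | val u \in L v0].
  by apply/card_gt0P; rewrite cL (leq_trans (k0 v0)).
have [|g [gL gG]] := choose U u1 (fun v => [set u : U | val u \in L v]).
  by move=> v; rewrite cL.
exists (fun v => val (g v)); split=> [v|i]; first by have := gL v; rewrite inE.
have [iU|iU] := boolP (i \in U).
  by apply: G_free_inducedS (gG [` iU]%fset); apply/subsetP=> v; rewrite !inE.
(* A color outside [U] has an empty class, contained in that of [u1]. *)
apply: G_free_inducedS (gG u1); apply/subsetP=> v; rewrite inE => /eqP vi.
by rewrite -vi (valP (g v)) in iU.
Qed.

Local Open Scope ring_scope.

Import Order.TTheory GRing.Theory Num.Theory.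

Lemma sqrt_bound_nat (R : rcfType) (n d k : nat) : (0 < d)%N -> (d * k <= n)%N ->
  n%:R <= d%:R * k%:R + Num.sqrt (d%:R * k%:R) - (d%:R - 1) :> R ->
  ((n - d * k + d - 1) ^ 2 <= d * k)%N.
Proof.
move=> d0 dkn; rewrite -natrM => nle.
rewrite -(ler_nat R) natrX -(sqr_sqrtr (ler0n R (d * k))).
rewrite lerXn2r ?nnegrE ?ler0n ?sqrtr_ge0 //.
rewrite natrB ?addn_gt0 ?d0 ?orbT // natrD natrB //.
lra.
Qed.

Theorem theorem2 (R : rcfType) (H G : sgraph) (d k : nat)
    (min_degG : is_min_degree G d)
    (chiGH : is_G_free_chromatic_number G H k)
    (cardH : #|H|%:R <= d%:R * k%:R + Num.sqrt (d%:R * k%:R) - (d%:R - 1) :> R) :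
  is_G_free_choice_number G H k.
Proof.
case: chiGH => Hk kmin; split; last by move=> j /choosable_colorable /kmin.
apply: (G_free_choosable_finite min_degG) => [v|U u0 L kL].
  by case: Hk => c _; apply: leq_ltn_trans (ltn_ord (c v)).
have [d0|d0] := posnP d; last first.
  apply: (list_coloring_finite u0 min_degG d0 Hk kL) => dkH.
  exact: sqrt_bound_nat d0 (ltnW dkH) cardH.
(* For [d = 0] the bound reads [#|H| <= 1], so any choice from the lists has its classes inside
   classes of [c]. *)
have {cardH} H1 : (#|H| <= 1)%N.
  by move: cardH; rewrite d0 !mul0r sqrtr0 addr0 sub0r opprB subr0 (ler_nat R _ 1).
have HE (v w : H) : v = w by apply: (fintype_le1P H1).
case: Hk => c cG.
have [u Lu] : exists u : H -> U, forall v, u v \in L v.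
  have Lne v : exists u, u \in L v.
    by apply/card_gt0P; apply: leq_trans (kL v); apply: leq_ltn_trans (ltn_ord (c v)).
  by exists (fun v => xchoose (Lne v)) => v; apply: xchooseP.
exists u; split=> // i.
have [->|[v _]] := set_0Vmem [set v | u v == i].
  by apply: (G_free_induced_small min_degG); rewrite cards0.
by apply: G_free_inducedS (cG (c v)); apply/subsetP=> w; rewrite !inE (HE w v).
Qed.
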